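(* Let $X$ be a standard Borel space and let $p$ be an exchangeable probability measure on $X^{\mathbb{N}}$. The following conditions are equivalent. \begin{enumerate} \item The measure $p$ is ergodic (under finite permutations). \item The corresponding measure $p_{\mathrm{inv}}$ on $X^{\mathbb{N}}_{\mathrm{inv}}$ is deterministic. \item For every $p$-a.s. deterministic, $p$-a.s. permutation-invariant morphism $s:X^{\mathbb{N}}\to Y$ (a Markov kernel to a standard Borel space $Y$), the measure $s\circ p$ is deterministic. \item The corresponding measure $\mu$ on $PX$ is a Dirac delta $\delta_q$ at some $q\in PX$. \item The measure $p$ displays independence of all the components $X$ in $X^{\mathbb{N}}$, i.e. it is an infinite product measure (equivalently, all its finite marginals are product measures). \end{enumerate}
   Context: A Markov kernel $k:X\to Y$ between measurable spaces assigns to $x\in X$ and measurable $B\subseteq Y$ a number $k(B|x)\in[0,1]$, being a probability measure in $B$ and measurable in $x$; for a measure $p$ on $X$, $(k\circ p)(B)=\int_X k(B|x)\,p(dx)$. Two kernels $f,g:X\to Y$ are $p$-a.s. equal, $f\simeq_p g$, if $\int_A f(B|x)\,p(dx)=\int_A g(B|x)\,p(dx)$ for all measurable $A,B$. A kernel $f:X\to Y$ is $p$-a.s. deterministic if $\int_A f(B\cap B'|x)\,p(dx)=\int_A f(B|x)f(B'|x)\,p(dx)$ for all measurable $A\subseteq X$ and $B,B'\subseteq Y$. A probability measure is deterministic if it takes only the values $0$ and $1$. $S_\infty$ is the group of finite permutations of $\mathbb{N}$, acting on $X^{\mathbb{N}}$ by permuting components; $p$ is exchangeable if it is invariant under this action.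 A kernel $s:X^{\mathbb{N}}\to Y$ is $p$-a.s. permutation-invariant if $s\circ\sigma\simeq_p s$ for all $\sigma\in S_\infty$. A measurable $A\subseteq X^{\mathbb{N}}$ is ($p$-a.s.) invariant if for all $\sigma\in S_\infty$, $1_{\sigma^{-1}(A)}=1_A$ $p$-almost surely; $X^{\mathbb{N}}_{\mathrm{inv}}$ is the set $X^{\mathbb{N}}$ with the $\sigma$-algebra of invariant sets, and $p_{\mathrm{inv}}$ is the restriction of $p$. The measure $p$ is called ergodic if $p_{\mathrm{inv}}$ is deterministic (in the paper's definition this is one of two equivalent conditions, the other being condition 3). $PX$ is the (standard Borel) space of probability measures on $X$, with $\sigma$-algebra generated by the evaluations $q\mapsto q(B)$, and $\mu$ is the unique probability measure on $PX$ with $p(A_1\times\dots\times A_n\times X\times\cdots)=\int_{PX}q(A_1)\cdots q(A_n)\,\mu(dq)$ for all $n$ and measurable $A_i\subseteq X$ (de Finetti). *)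

(* Defs.v *)
From HB Require Import structures.
From mathcomp Require Import all_boot all_order all_algebra.
From mathcomp Require Import all_classical all_reals all_analysis.

Set Implicit Arguments.
Unset Strict Implicit.
Unset Printing Implicit Defensive.

Import Order.TTheory GRing.Theory Num.Theory.

Local Open Scope classical_set_scope.
Local Open Scope ring_scope.
Local Open Scope ereal_scope.

(* As [measurableType] is pointed, the empty standard Borel space is left out.
   There is no probability measure on its sequence space, and no kernel into it
   from a nonempty space. *)
Definition standard_borel (R : realType) d (T : measurableType d) : Prop :=
  exists (S : metricType R) (f : T -> S),
    [/\ forall F : set_system S, ProperFilter F -> cauchy F ->
          exists x : S, F --> x,
        exists2 D : set S, countable D & dense D,
        bijective f &
        @measurable d T = [set f @^-1` B | B in <<s [set U : set S | open U] >>]].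

Section sequence_space.
Context d (X : measurableType d).

Definition cylinders : set (set (nat -> X)) :=
  \bigcup_i preimage_set_system [set: nat -> X] (fun x => x i) measurable.

Definition seq_space : measurableType cylinders.-sigma :=
  g_sigma_algebraType cylinders.

Definition coord (i : nat) (x : seq_space) : X := x i.

Definition permute (s : nat -> nat) (x : seq_space) : seq_space :=
  fun i => coord (s i) x.

Definition box (n : nat) (A : nat -> set X) : set seq_space :=
  [set x | forall i, (i < n)%N -> A i (coord i x)].

End sequence_space.

Definition finite_perm (s : nat -> nat) : Prop :=
  bijective s /\ finite_set [set i | s i != i].

Definition exchangeable (R : realType) d (X : measurableType d)
    (p : probability (seq_space X) R) : Prop :=
  forall s, finite_perm s ->
  forall A, measurable A -> pushforward p (permute s) A = p A.

Definition deterministic (R : realType) d (T : measurableType d)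
    (P : probability T R) : Prop :=
  forall A, measurable A -> P A = 0 \/ P A = 1.

Section invariant_sigma_algebra.
Context (R : realType) d (X : measurableType d).
Variable p : probability (seq_space X) R.

Definition invariant_set (A : set (seq_space X)) : Prop :=
  measurable A /\
  forall s, finite_perm s ->
    (\1_(permute s @^-1` A) : seq_space X -> R) = \1_A %[ae p].

Let invariant_setP (A : set (seq_space X)) : invariant_set A <->
  (measurable A /\ forall s, finite_perm s ->
    \forall x \ae p, A (permute s x) <-> A x).
Proof.
have E s : (\1_(permute s @^-1` A) : seq_space X -> R) = \1_A %[ae p] <->
    \forall x \ae p, A (permute s x) <-> A x.
  split; apply: filterS => x.
    move=> /(_ Logic.I) /eqP; rewrite !indicE eqr_nat => /eqP AE.
    have := congr1 (leq 1) AE; rewrite !lt0b -!(in_setE A) => <-.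
    by rewrite !in_setE.
  by move=> AE _; rewrite !indicE; congr ((nat_of_bool _)%:R);
     apply/idP/idP; rewrite !in_setE => /AE.
by split=> -[mA h]; split=> // s /h /E.
Qed.

Let invariant_set0 : invariant_set set0.
Proof. by apply/invariant_setP; split=> // s _; exact: aeW. Qed.

Let invariant_setC A : invariant_set A -> invariant_set (~` A).
Proof.
move=> /invariant_setP[mA h]; apply/invariant_setP.
split; first exact: measurableC.
by move=> s /h; apply: filterS => x /= ->.
Qed.

Let invariant_set_bigcup (F : (set (seq_space X))^nat) :
  (forall i, invariant_set (F i)) -> invariant_set (\bigcup_i F i).
Proof.
move=> h; apply/invariant_setP; split.
  by apply: bigcupT_measurable => i; case: (h i).
move=> s fs.
have : \forall x \ae p, forall i, F i (permute s x) <-> F i x.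
  by apply: ae_foralln => i; case/invariant_setP: (h i) => _; apply.
by apply: filterS => x hx; split=> -[i _ Fi]; exists i => //; apply/hx.
Qed.

Definition inv_space of probability (seq_space X) R : Type := nat -> X.

Definition inv_display : measure_display. Proof. by constructor. Qed.

HB.instance Definition _ := Pointed.on (inv_space p).
HB.instance Definition _ := @isMeasurable.Build inv_display (inv_space p)
  invariant_set invariant_set0 invariant_setC invariant_set_bigcup.

Definition p_inv (A : set (inv_space p)) : \bar R := p A.

Let p_inv0 : p_inv set0 = 0.
Proof. exact: measure0. Qed.

Let p_inv_ge0 A : 0 <= p_inv A.
Proof. exact: measure_ge0. Qed.

Let p_inv_sigma_additive : semi_sigma_additive p_inv.
Proof.
move=> F mF tF mUF; apply: (@measure_semi_sigma_additive _ _ _ p) => //.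
- by move=> i; case: (mF i).
- by case: mUF.
Qed.

HB.instance Definition _ := isMeasure.Build _ _ _ p_inv
  p_inv0 p_inv_ge0 p_inv_sigma_additive.

Let p_inv_setT : p_inv setT = 1.
Proof. exact: probability_setT. Qed.

HB.instance Definition _ := Measure_isProbability.Build _ _ _ p_inv p_inv_setT.

End invariant_sigma_algebra.
Arguments p_inv {R d X} p A.

Definition ergodic (R : realType) d (X : measurableType d)
    (p : probability (seq_space X) R) : Prop := deterministic (p_inv p).

Section kernels.
Context (R : realType) d d' (X : measurableType d) (Y : measurableType d').
Variable p : probability X R.

(* Kernels are taken here as plain measure-valued functions, so that the
   composite of a kernel with a permutation is just [s \o permute sigma]. *)
Definition kernel_ae_eq (f g : X -> {measure set Y -> \bar R}) : Prop :=
  forall A B, measurable A -> measurable B ->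
    \int[p]_(x in A) f x B = \int[p]_(x in A) g x B.

Definition ae_deterministic (f : X -> {measure set Y -> \bar R}) : Prop :=
  forall A B B', measurable A -> measurable B -> measurable B' ->
    \int[p]_(x in A) f x (B `&` B') = \int[p]_(x in A) (f x B * f x B').

End kernels.

Definition ae_permutation_invariant (R : realType) d d' (X : measurableType d)
    (Y : measurableType d') (p : probability (seq_space X) R)
    (f : seq_space X -> {measure set Y -> \bar R}) : Prop :=
  forall s, finite_perm s -> kernel_ae_eq p (f \o permute s) f.

Section kernel_image.
Context (R : realType) d d' (X : measurableType d) (Y : measurableType d').
Variables (p : probability X R) (k : R.-pker X ~> Y).

Definition kernel_image (B : set Y) : \bar R := \int[p]_x k x B.

Let kernel_image0 : kernel_image set0 = 0.
Proof.
rewrite /kernel_image; under eq_integral do rewrite measure0.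
exact: integral0.
Qed.

Let kernel_image_ge0 B : 0 <= kernel_image B.
Proof. by apply: integral_ge0. Qed.

Let kernel_image_sigma_additive : semi_sigma_additive kernel_image.
Proof.
exact: (@measure_semi_sigma_additive _ _ _
  (mkcomp_noparam (kprobability (measurable_cst (p : pprobability X R) :
     measurable_fun [set: unit] _)) k tt)).
Qed.

HB.instance Definition _ := isMeasure.Build _ _ _ kernel_image
  kernel_image0 kernel_image_ge0 kernel_image_sigma_additive.

Let kernel_image_setT : kernel_image setT = 1.
Proof.
rewrite /kernel_image; under eq_integral do rewrite prob_kernel.
by rewrite integral_cst// mul1e; exact: probability_setT.
Qed.

HB.instance Definition _ := Measure_isProbability.Build _ _ _ kernel_image
  kernel_image_setT.

End kernel_image.

(* [pprobability X R] is PX, with the sigma-algebra generated by the evaluations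
   at measurable sets. *)
Definition mixing_measure (R : realType) d (X : measurableType d)
    (p : probability (seq_space X) R)
    (mu : probability (pprobability X R) R) : Prop :=
  forall (n : nat) (A : nat -> set X), (forall i, measurable (A i)) ->
    p (box n A) =
    \int[mu]_q \prod_(i < n) (q : probability X R) (A i).

(* A Rocq [probability] also assigns values to non-measurable sets, so measures
   are compared on measurable sets only. The two clauses say that mu is the
   unique measure given by de Finetti's theorem. *)
Definition is_de_finetti_measure (R : realType) d (X : measurableType d)
    (p : probability (seq_space X) R)
    (mu : probability (pprobability X R) R) : Prop :=
  mixing_measure p mu /\
  forall nu, mixing_measure p nu -> forall B, measurable B -> nu B = mu B.

Definition is_dirac (R : realType) d (T : measurableType d)
    (P : probability T R) : Prop :=
  exists t : T, forall B, measurable B -> P B = \d_t B.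

Definition is_product_of (R : realType) d (X : measurableType d)
    (p : probability (seq_space X) R) (q : nat -> set X -> \bar R) : Prop :=
  forall (n : nat) (A : nat -> set X), (forall i, measurable (A i)) ->
    p (box n A) = \prod_(i < n) q i (A i).

Definition independent_components (R : realType) d (X : measurableType d)
    (p : probability (seq_space X) R) : Prop :=
  is_product_of p (fun i => pushforward p (@coord _ X i)).

Lemma independent_componentsP (R : realType) d (X : measurableType d)
    (p : probability (seq_space X) R) :
  independent_components p <->
  exists q : nat -> probability X R, is_product_of p q.
Proof.
split=> [h|[q h] n A mA].
  have mc i : measurable_fun [set: seq_space X] (@coord _ X i).
    move=> _ B mB; apply: sub_sigma_algebra; exists i => //.
    by exists B.
  pose c i : {mfun seq_space X >-> X} :=
    HB.pack (@coord _ X i) (isMeasurableFun.Build _ _ _ _ _ (mc i)).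
  by exists (fun i => distribution p (c i)).
rewrite (h n A mA); apply: eq_bigr => i _; rewrite /pushforward.
pose A' j := if j == i :> nat then A i else setT.
have mA' j : measurable (A' j) by rewrite /A'; case: ifP.
have -> : coord (nat_of_ord i) @^-1` A i = box i.+1 A'.
  apply/seteqP; split=> x /=.
    by move=> Ax j _; rewrite /A'; case: eqP => [->|].
  by move=> /(_ i (ltnSn i)); rewrite /A' eqxx.
rewrite (h _ _ mA') big_ord_recr /= {2}/A' eqxx big1 ?mul1e// => j _.
by rewrite /A' ltn_eqF ?ltn_ord//; exact: probability_setT.
Qed.

(* Main.v *)
(* Let p be exchangeable, hence invariant under the shift. If nu <= p is
   another exchangeable measure, then its density with respect to p is a.s.
   invariant, so that nu is proportional to p when p is ergodic. Applied to
   nu(C) = p(x_0 in B, shift x in C), this shows that the first component is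
   independent of the others, and p is the infinite power of a measure q. The
   first two moments of r(B) under a mixing measure of p are then q(B) and
   q(B)^2, so r(B) is a.s. constant and the mixing measure is delta_q.
   Conversely, if p is a product and D is invariant, the events x_i in B are
   pairwise independent and all have the same intersection probability with D
   (or with D and a box in earlier components); Bessel's inequality forces this
   probability to be the product, hence p(D and C) = p(D) p(C) for all C, and
   C = D gives p(D) = 0 or 1. *)
From Pilot Require Import Defs.
From HB Require Import structures.
From mathcomp Require Import all_boot all_order all_algebra.
From mathcomp Require Import all_classical all_reals all_analysis.
From mathcomp Require Import measurable_realfun ring lra.

Set Implicit Arguments.
Unset Strict Implicit.
Unset Printing Implicit Defensive.

Import Order.TTheory GRing.Theory Num.Theory.
Import numFieldNormedType.Exports.
(* [coord] would otherwise denote the coordinates of [mathcomp.vector]. *)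
Import Pilot.Defs.

Local Open Scope classical_set_scope.
Local Open Scope ring_scope.
Local Open Scope ereal_scope.

(** * Boxes as a generating pi-system of the sequence space *)

Section sequence_space_theory.
Context d (X : measurableType d).
Implicit Types (A B : nat -> set X) (s : nat -> nat).

Lemma measurable_coord i : measurable_fun [set: seq_space X] (@coord _ X i).
Proof.
by move=> _ B mB; apply: sub_sigma_algebra; exists i => //; exists B.
Qed.

HB.instance Definition _ i :=
  isMeasurableFun.Build _ _ _ _ (@coord _ X i) (measurable_coord i).

Lemma measurable_into_seq_space d' (T : measurableType d')
    (f : T -> seq_space X) :
  (forall i, measurable_fun [set: T] (@coord _ X i \o f)) ->
  measurable_fun [set: T] f.
Proof.
move=> mf; apply: (@measurability _ _ T (seq_space X) _ _ (@cylinders _ X)) => //.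
move=> _ [C [i _ [B mB <-]] <-].
by rewrite setTI; have := mf i measurableT B mB; rewrite !setTI.
Qed.

Lemma measurable_permute s : measurable_fun [set: seq_space X] (permute s).
Proof.
by apply: measurable_into_seq_space => i; exact: (measurable_coord (s i)).
Qed.

Definition shift (x : seq_space X) : seq_space X := fun i => coord i.+1 x.

Lemma measurable_shift : measurable_fun [set: seq_space X] shift.
Proof.
by apply: measurable_into_seq_space => i; exact: (measurable_coord i.+1).
Qed.

HB.instance Definition _ :=
  isMeasurableFun.Build _ _ _ _ shift measurable_shift.

Lemma measurable_preimage d1 d2 (T1 : measurableType d1)
    (T2 : measurableType d2) (f : T1 -> T2) (B : set T2) :
  measurable_fun [set: T1] f -> measurable B -> measurable (f @^-1` B).
Proof. by move=> mf mB; rewrite -[_ @^-1` _]setTI; exact: mf. Qed.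

Lemma box0 A : box 0 A = setT.
Proof. by apply/seteqP; split. Qed.

Lemma boxS n A : box n.+1 A = box n A `&` (@coord _ X n @^-1` A n).
Proof.
apply/seteqP; split=> x /=.
  by move=> Ax; split=> [i /ltnW|]; exact: Ax.
by move=> [Ax An] i; rewrite ltnS leq_eqVlt => /predU1P[->|/Ax].
Qed.

Lemma boxSl n A :
  box n.+1 A = (@coord _ X 0 @^-1` A 0%N) `&` shift @^-1` box n (A \o succn).
Proof.
apply/seteqP; split=> x /=.
  by move=> Ax; split=> [|i ?]; exact: Ax.
by move=> [A0 Ax] [//|i] /Ax.
Qed.

Lemma measurable_box n A : (forall i, measurable (A i)) -> measurable (box n A).
Proof.
move=> mA; elim: n => [|n IH]; first by rewrite box0.
by rewrite boxS; apply: measurableI => //;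
   exact: (measurable_preimage (measurable_coord n)).
Qed.

Definition boxes : set (set (seq_space X)) :=
  [set C | exists n A, (forall i, measurable (A i)) /\ C = box n A].

Lemma boxes_setI_closed : setI_closed boxes.
Proof.
move=> _ _ [n [A [mA ->]]] [m [B [mB ->]]].
(* Both boxes are padded with [setT] to a common length. *)
exists (maxn n m), (fun i => (if (i < n)%N then A i else setT) `&`
                             (if (i < m)%N then B i else setT)).
split=> [i|]; first by apply: measurableI; case: ifP.
apply/seteqP; split=> x /=.
  by move=> [Ax Bx] i _; split; [case: ifP => // /Ax|case: ifP => // /Bx].
move=> ABx; split=> i im.
  by have [+ _] := ABx i (leq_trans im (leq_maxl _ _)); rewrite im.
by have [_] := ABx i (leq_trans im (leq_maxr _ _)); rewrite im.
Qed.

Lemma boxesT : boxes setT.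
Proof. by exists 0%N, (fun=> setT); split=> //; rewrite box0. Qed.

(** The sides of a cylinder over the single coordinate [i], seen as a box. *)
Definition at_coord i (B : set X) j := if j == i :> nat then B else setT.

Lemma measurable_at_coord i (B : set X) j :
  measurable B -> measurable (at_coord i B j).
Proof. by rewrite /at_coord; case: ifP. Qed.

Lemma preimage_coord_box i (B : set X) n : (i < n)%N ->
  @coord _ X i @^-1` B = box n (at_coord i B).
Proof.
move=> i_n; apply/seteqP; split=> x /=.
  by move=> Bx j _; rewrite /at_coord; case: eqP => // ->.
by move=> /(_ i i_n); rewrite /at_coord eqxx.
Qed.

Lemma measurable_seq_spaceE : @measurable _ (seq_space X) = <<s boxes >>.
Proof.
apply/seteqP; split; last first.
  apply: smallest_sub; first exact: sigma_algebra_measurable.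
  by move=> _ [n [A [mA ->]]]; exact: measurable_box.
apply: smallest_sub; first exact: smallest_sigma_algebra.
move=> _ [i _ [B mB <-]]; apply: sub_sigma_algebra.
exists i.+1, (at_coord i B).
split=> [j|]; first exact: measurable_at_coord.
by rewrite setTI -preimage_coord_box.
Qed.

(** Boxes form a generating pi-system that contains the whole space as [box 0]; agreement there
    makes [m2] finite as well. *)
Lemma box_measure_unique (R : realType)
    (m1 m2 : {measure set (seq_space X) -> \bar R}) :
  m1 setT < +oo ->
  (forall n A, (forall i, measurable (A i)) -> m1 (box n A) = m2 (box n A)) ->
  forall C, measurable C -> m1 C = m2 C.
Proof.
move=> m1oo m12 C; rewrite measurable_seq_spaceE => mC.
apply: (@g_sigma_algebra_measure_unique _ _ _ boxes _ (fun=> setT)) mC => //.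
- by move=> D bD; rewrite measurable_seq_spaceE; exact: sub_sigma_algebra.
- by move=> _; exact: boxesT.
- by apply/seteqP; split=> // x _; exists 0%N.
- exact: boxes_setI_closed.
- by move=> _ [n [A [mA ->]]]; exact: m12.
Qed.

End sequence_space_theory.

(** * Bessel's inequality and pairwise independent events *)

Section bessel.
Context d (T : measurableType d) (R : realType) (P : probability T R).
Implicit Types (f g : T -> R).
Local Open Scope ring_scope.

(** This class is stable under sums and products and integrable for every probability, so the
    integrability conditions in second-moment computations reduce to closure properties. *)
Definition bounded_measurable f :=
  measurable_fun setT f /\ exists M, forall x, `|f x| <= M.

Lemma bounded_measurableD f g : bounded_measurable f -> bounded_measurable g ->
  bounded_measurable (fun x => f x + g x).
Proof.
move=> [mf [M fM]] [mg [N gN]]; split; first exact: measurable_funD.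
by exists (M + N) => x; rewrite (le_trans (ler_normD _ _))// lerD.
Qed.

Lemma bounded_measurableM f g : bounded_measurable f -> bounded_measurable g ->
  bounded_measurable (fun x => f x * g x).
Proof.
move=> [mf [M fM]] [mg [N gN]]; split; first exact: measurable_funM.
by exists (M * N) => x; rewrite normrM ler_pM.
Qed.

Lemma bounded_measurable_cst (c : R) : bounded_measurable (fun=> c).
Proof. by split; [exact: measurable_cst|exists `|c|]. Qed.

Lemma bounded_measurable_indic (A : set T) : measurable A ->
  bounded_measurable (\1_A : T -> R).
Proof.
move=> mA; split; first exact: measurable_indic.
by exists 1 => x; rewrite indicE; case: (_ \in _); rewrite ?normr1 ?normr0.
Qed.

Lemma bounded_measurable_sum n (f : nat -> T -> R) :
  (forall i, bounded_measurable (f i)) ->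
  bounded_measurable (fun x => \sum_(i < n) f i x).
Proof.
move=> bf; elim: n => [|n IH].
  by under eq_fun do rewrite big_ord0; exact: bounded_measurable_cst.
by under eq_fun do rewrite big_ord_recr; exact: bounded_measurableD.
Qed.

Lemma bounded_measurable_integrable f : bounded_measurable f ->
  P.-integrable setT (EFin \o f).
Proof.
move=> [mf [M fM]]; apply: measurable_bounded_integrable => //.
  by apply: (le_lt_trans (probability_le1 _ _)) => //; rewrite ltry.
exists M; split; first exact: num_real.
by move=> y My x _; exact: le_trans (fM x) (ltW My).
Qed.

Let I f : R := \int[P]_x f x.

Lemma RintegralT_indic (A : set T) : measurable A -> I \1_A = fine (P A).
Proof. by move=> mA; rewrite /I /Rintegral integral_indic ?setIT. Qed.

Lemma RintegralTD f g : bounded_measurable f -> bounded_measurable g ->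
  I (fun x => f x + g x) = I f + I g.
Proof.
by move=> bf bg; rewrite /I RintegralD//; exact: bounded_measurable_integrable.
Qed.

Lemma RintegralTZl (c : R) f : bounded_measurable f ->
  I (fun x => c * f x) = c * I f.
Proof.
by move=> bf; rewrite /I RintegralZl//; exact: bounded_measurable_integrable.
Qed.

Lemma RintegralT_cst (c : R) : I (fun=> c) = c.
Proof.
rewrite /I Rintegral_cst//; transitivity (c * fine (P setT)) => //.
by rewrite probability_setT mulr1.
Qed.

Lemma RintegralT_sum n (f : nat -> T -> R) :
  (forall i, bounded_measurable (f i)) ->
  I (fun x => \sum_(i < n) f i x) = \sum_(i < n) I (f i).
Proof.
move=> bf; elim: n => [|n IH].
  rewrite big_ord0 -[RHS](RintegralT_cst 0); congr I.
  by apply/funext => x; rewrite big_ord0.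
rewrite big_ord_recr/= -IH -RintegralTD//; last exact: bounded_measurable_sum.
by congr I; apply/funext => x; rewrite big_ord_recr.
Qed.

(* Bessel's inequality bounds n v^2 independently of n. *)
Lemma constant_inner_product_eq0 f (h : nat -> T -> R) (K v : R) :
  bounded_measurable f -> (forall i, bounded_measurable (h i)) ->
  (forall i, I (fun x => h i x * h i x) <= K) ->
  (forall i j, i != j -> I (fun x => h i x * h j x) = 0) ->
  (forall i, I (fun x => f x * h i x) = v) -> v = 0.
Proof.
move=> bf bh hK h0 fv.
pose S n x := \sum_(i < n) h i x.
have bS n : bounded_measurable (S n) by exact: bounded_measurable_sum.
have fS n : I (fun x => f x * S n x) = n%:R * v.
  transitivity (\sum_(i < n) I (fun x => f x * h i x)).
    rewrite -(@RintegralT_sum n (fun i x => f x * h i x)); last first.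
      by move=> i; exact: bounded_measurableM.
    by congr I; apply/funext => x; rewrite mulr_sumr.
  by rewrite (eq_bigr (fun=> v))// sumr_const card_ord mulr_natl.
(* Orthogonality removes the cross term at each step, so the squared norm of [S n] grows at most
   linearly. *)
have SS n : I (fun x => S n x * S n x) <= n%:R * K.
  elim: n => [|n IH].
    rewrite mul0r -[leRHS](RintegralT_cst 0) le_eqVlt; apply/predU1P; left.
    by congr I; apply/funext => x; rewrite /S big_ord0 mul0r.
  have -> : (fun x => S n.+1 x * S n.+1 x) = (fun x => S n x * S n x +
      (2 * (S n x * h n x) + h n x * h n x)).
    by apply/funext => x; rewrite /S big_ord_recr/=; ring.
  have bShn := bounded_measurableM (bS n) (bh n).
  have b2Shn := bounded_measurableM (bounded_measurable_cst 2) bShn.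
  have bhh := bounded_measurableM (bh n) (bh n).
  rewrite RintegralTD; [|exact: bounded_measurableM|exact: bounded_measurableD].
  rewrite RintegralTD// RintegralTZl//.
  have -> : I (fun x => S n x * h n x) = 0.
    transitivity (\sum_(i < n) I (fun x => h i x * h n x)).
      rewrite -(@RintegralT_sum n (fun i x => h i x * h n x)); last first.
        by move=> i; exact: bounded_measurableM.
      by congr I; apply/funext => x; rewrite mulr_suml.
    by rewrite big1// => i _; rewrite h0// ltn_eqF.
  by rewrite mulr0 add0r -natr1 mulrDl mul1r lerD.
have bff := bounded_measurableM bf bf.
(* The squared norm of [f - t * S n] is expanded, and [SS] bounds its last term. *)
have expand n t :
    0 <= I (fun x => f x * f x) - 2 * t * (n%:R * v) + t ^+ 2 * (n%:R * K).
  have : 0 <= I (fun x => (f x - t * S n x) * (f x - t * S n x)).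
    by apply: Rintegral_ge0 => x _; rewrite -expr2 sqr_ge0.
  have -> : (fun x => (f x - t * S n x) * (f x - t * S n x)) =
      (fun x => f x * f x + (- (2 * t) * (f x * S n x) + t ^+ 2 * (S n x * S n x))).
    by apply/funext => x; ring.
  have b1 := bounded_measurableM bf (bS n).
  have b2 := bounded_measurableM (bS n) (bS n).
  have b1' := bounded_measurableM (bounded_measurable_cst (- (2 * t))) b1.
  have b2' := bounded_measurableM (bounded_measurable_cst (t ^+ 2)) b2.
  rewrite RintegralTD//; last exact: bounded_measurableD.
  rewrite RintegralTD// RintegralTZl// RintegralTZl// fS.
  move=> /le_trans; apply; rewrite mulNr addrA lerD2l.
  by rewrite ler_wpM2l ?sqr_ge0.
apply/eqP/negPn/negP => v0.
have K0 : 0 <= K.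
  by apply: le_trans (hK 0%N); apply: Rintegral_ge0 => x _; rewrite -expr2 sqr_ge0.
pose C := I (fun x => f x * f x).
have C0 : 0 <= C by apply: Rintegral_ge0 => x _; rewrite -expr2 sqr_ge0.
(* the choice t = v / (K + 1) gives n v^2 <= C (K + 1) for all n *)
have bd n : n%:R * v ^+ 2 <= C * (K + 1).
  have K1 : 0 < K + 1 by lra.
  have := expand n (v / (K + 1)); rewrite -/C.
  rewrite -(pmulr_rge0 _ K1).
  set e := (X in 0 <= X).
  have -> : e = C * (K + 1) - n%:R * v ^+ 2 * (2 - K / (K + 1)).
    by rewrite /e; field; rewrite gt_eqF.
  rewrite subr_ge0; apply: le_trans; rewrite ler_peMr//.
    by rewrite mulr_ge0// sqr_ge0.
  by rewrite lerBrDr -lerBrDl ler_pdivrMr//; lra.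
have v2 : 0 < v ^+ 2 by rewrite exprn_even_gt0.
(* This integer exceeds [C * (K + 1) / v ^+ 2], which contradicts [bd]. *)
have := bd (Num.trunc (C * (K + 1) / v ^+ 2)).+1.
rewrite -ler_pdivlMr// leNgt => /negP; apply.
by rewrite truncnS_gt.
Qed.

(** The centred indicators of the [E i] are pairwise orthogonal and bounded in L2, and all have
    inner product [w - P D * c] with the indicator of [D]. Bessel's inequality makes this number
    zero. *)
Lemma pairwise_independent_constant_inter (D : set T) (E : nat -> set T)
    (c w : R) :
  measurable D -> (forall i, measurable (E i)) ->
  (forall i, P (E i) = c%:E) ->
  (forall i j, i != j -> P (E i `&` E j) = (c * c)%:E) ->
  (forall i, P (D `&` E i) = w%:E) -> w%:E = (P D * c%:E)%E.
Proof.
move=> mD mE Pc Pcc Pw.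
pose h i x := (\1_(E i) x - c : R).
have bE i := bounded_measurable_indic (mE i).
have bD := bounded_measurable_indic mD.
have bc := bounded_measurable_cst.
have bh i : bounded_measurable (h i) by exact: bounded_measurableD.
have II A B x : \1_A x * \1_B x = \1_(A `&` B) x :> R.
  rewrite !indicE in_setI.
  by case: (_ \in _); case: (_ \in _); rewrite /= ?mulr1 ?mulr0.
have hh i j : I (fun x => h i x * h j x) = fine (P (E i `&` E j)) - c * c.
  have -> : (fun x => h i x * h j x) = (fun x => \1_(E i `&` E j) x +
     (- c * \1_(E i) x + (- c * \1_(E j) x + c * c))).
    by apply/funext => x; rewrite -II /h; ring.
  have mEE : measurable (E i `&` E j) by exact: measurableI.
  rewrite RintegralTD; [|exact: bounded_measurable_indic|]; last first.
    by do 2?[apply: bounded_measurableD; first exact: bounded_measurableM].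
  rewrite RintegralTD; [|exact: bounded_measurableM|]; last first.
    by apply: bounded_measurableD => //; exact: bounded_measurableM.
  rewrite RintegralTD//; last exact: bounded_measurableM.
  rewrite !RintegralTZl// RintegralT_cst !RintegralT_indic// !Pc/=; ring.
have : w - fine (P D) * c = 0.
  (* The squared norm of [h i] is [P (E i) - c * c], whence the bound. *)
  apply: (@constant_inner_product_eq0 \1_D h (1 + `|c * c|)) => // [i|i j ij|i].
  - rewrite hh lerD//; last by rewrite -normrN ler_norm.
    by rewrite setIid -[1]/(fine 1%E) fine_le ?fin_num_measure// probability_le1.
  - by rewrite hh Pcc// subrr.
  have -> : (fun x => \1_D x * h i x) = (fun x => \1_(D `&` E i) x + - c * \1_D x).
    by apply/funext => x; rewrite -II /h; ring.
  have mDE : measurable (D `&` E i) by exact: measurableI.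
  rewrite RintegralTD; [|exact: bounded_measurable_indic|exact: bounded_measurableM].
  by rewrite RintegralTZl// !RintegralT_indic// Pw/=; ring.
by move/eqP; rewrite subr_eq0 => /eqP ->; rewrite EFinM fineK// fin_num_measure.
Qed.

End bessel.

(** * Finite permutations: swaps, cycles and lifts *)

Lemma finite_perm_bounded (s t : nat -> nat) n : cancel s t -> cancel t s ->
  (forall i, (n < i)%N -> s i = i) -> finite_perm s.
Proof.
move=> st ts sn; split; first by exists t.
apply: (@sub_finite_set _ _ `I_n.+1) => [i /=|]; last exact: finite_II.
by rewrite ltnS leqNgt => /eqP si; apply/negP => /sn.
Qed.

Definition nat_swap i j k : nat :=
  if k == i then j else if k == j then i else k.

Lemma nat_swap_l i j : nat_swap i j i = j.
Proof. by rewrite /nat_swap eqxx. Qed.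

Lemma nat_swap_lt i j k : (k < i)%N -> (k < j)%N -> nat_swap i j k = k.
Proof. by move=> ki kj; rewrite /nat_swap !ltn_eqF. Qed.

Lemma finite_perm_swap i j : finite_perm (nat_swap i j).
Proof.
have K : involutive (nat_swap i j).
  by move=> k; rewrite /nat_swap; do ![case: eqP => //=] => *; subst.
apply: (finite_perm_bounded K K (n := maxn i j)) => k.
by rewrite gtn_max => /andP[ik jk]; rewrite /nat_swap !gtn_eqF.
Qed.

(** The cycle sending 0 to 1, 1 to 2, and so on up to [n], and [n] back to 0, imitates the shift,
    which is not a permutation, on the first [n] coordinates. *)
Lemma finite_perm_cycle n :
  exists2 s, finite_perm s & forall i, (i < n)%N -> s i = i.+1.
Proof.
pose s i := if (i < n)%N then i.+1 else if i == n then 0%N else i.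
pose t i := if i is j.+1 then if (j < n)%N then j else i else n.
exists s; last by move=> i i_n; rewrite /s i_n.
apply: (@finite_perm_bounded s t n) => [i|i|i]; rewrite /s.
- case: ltnP => [/= ->//|]; case: eqP => [->//|/eqP ni] ni'.
  case: i ni ni' => [|i]/= ni ni'; last first.
    by rewrite ltnNge -ltnS ltn_neqAle eq_sym ni ni'.
  by move: ni'; rewrite leqn0 eq_sym (negbTE ni).
- case: i => [|i] /=; first by rewrite ltnn eqxx.
  case: (ltnP i n) => [->//|ni]; have -> : (i.+1 < n)%N = false by rewrite ltnNge leqW.
  by rewrite gtn_eqF.
- by move=> ni; rewrite ltnNge ltnW//= gtn_eqF.
Qed.

(** Permuting by the lift and then shifting is the same as shifting and then permuting by [s], and
    coordinate 0 is kept. *)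
Definition perm_lift (s : nat -> nat) i := if i is j.+1 then (s j).+1 else 0%N.

Lemma finite_perm_lift s : finite_perm s -> finite_perm (perm_lift s).
Proof.
move=> [[t st ts] fs]; split.
  by exists (perm_lift t) => -[|i]//=; rewrite ?st ?ts.
apply: (@sub_finite_set _ _ (succn @` [set i | s i != i])); last first.
  exact: finite_image.
by move=> [|i]//= si; exists i.
Qed.

(** * Invariant sets and the ergodicity of exchangeable product measures *)

Section indicator_ae.
Context d (T : measurableType d) (R : realType) (P : probability T R).

Lemma measureI_ae_eq (A B C : set T) :
  measurable A -> measurable B -> measurable C ->
  (\1_A : T -> R) = \1_B %[ae P] -> P (A `&` C) = P (B `&` C).
Proof.
move=> mA mB mC AB; rewrite -!integral_indic//.
apply: ge0_ae_eq_integral => //.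
- by apply/measurable_EFinP; exact: measurable_indic.
- by apply/measurable_EFinP; exact: measurable_indic.
by apply: filterS AB => x /(_ Logic.I) + _ => /= ->.
Qed.

End indicator_ae.

Section exchangeable_theory.
Context (R : realType) d (X : measurableType d).
Variable p : probability (seq_space X) R.
Hypothesis hp : exchangeable p.
Implicit Types (A : nat -> set X) (C D : set (seq_space X)).

(** On a box of length [n] the shift acts as a finite cycle, and boxes determine the measure. *)
Lemma exchangeable_shift C : measurable C -> p (@shift _ X @^-1` C) = p C.
Proof.
apply: (@box_measure_unique _ X R (distribution p (@shift _ X)) p).
  exact: le_lt_trans (probability_le1 (distribution p _) _) (ltry _).
move=> n A mA; have [s fs sE] := finite_perm_cycle n.
change (p (@shift _ X @^-1` box n A) = p (box n A)).
rewrite -(hp fs (measurable_box n mA)) /pushforward.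
by congr (p _); apply/seteqP; split=> x /= Ax i i_n; move: (Ax i i_n);
  rewrite /shift /permute /coord sE.
Qed.

(** Up to a null set [D] is its own preimage, so exchangeability applies to the whole
    intersection. *)
Lemma invariant_set_setI D C s : invariant_set p D -> measurable C ->
  finite_perm s -> p (D `&` permute s @^-1` C) = p (D `&` C).
Proof.
move=> [mD iD] mC fs.
have mpre E : measurable E -> measurable (permute s @^-1` E).
  exact: (measurable_preimage (measurable_permute s)).
rewrite -(hp fs (measurableI _ _ mD mC)) /pushforward preimage_setI.
apply: measureI_ae_eq; [exact: mD|exact: mpre|exact: mpre|].
by have := iD s fs; apply: filterS => x h /h.
Qed.

Lemma preimage_coord_swap i j (B : set X) :
  permute (nat_swap i j) @^-1` (@coord _ X i @^-1` B) = @coord _ X j @^-1` B.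
Proof.
by apply/seteqP; split=> x /=; rewrite /permute /coord /= nat_swap_l.
Qed.

Lemma box_swap n i j A : (n <= i)%N -> (n <= j)%N ->
  permute (nat_swap i j) @^-1` box n A = box n A.
Proof.
move=> ni nj; apply/seteqP; split=> x /= Ax k kn; move: (Ax k kn);
  by rewrite /permute /coord nat_swap_lt ?(leq_trans kn).
Qed.

Hypothesis ip : independent_components p.

(** For [i < j] the intersection is a box of length [j.+1] whose other sides are [setT] and
    contribute factors 1. *)
Lemma independent_coord2 i j (B C : set X) : i != j ->
  measurable B -> measurable C ->
  p (@coord _ X i @^-1` B `&` @coord _ X j @^-1` C) =
  p (@coord _ X i @^-1` B) * p (@coord _ X j @^-1` C).
Proof.
wlog ij : i j B C / (i < j)%N => [h|] i_j mB mC.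
  by have := i_j; rewrite neq_ltn => /orP[ij|ji]; [exact: h|
     rewrite setIC muleC h// eq_sym].
pose A k := if k == i then B else at_coord j C k.
have mA k : measurable (A k).
  by rewrite /A; case: ifP => // _; exact: measurable_at_coord.
have -> : @coord _ X i @^-1` B `&` @coord _ X j @^-1` C = box j.+1 A.
  apply/seteqP; split=> x /=.
    by move=> [Bx Cx] k _; rewrite /A /at_coord; do !case: eqP => [->|_].
  move=> Ax; split; first by have := Ax i (ltnW ij); rewrite /A eqxx.
  by have := Ax j (ltnSn j); rewrite /A /at_coord eqxx gtn_eqF.
have pA k : k != i -> k != j -> pushforward p (@coord _ X k) (A k) = 1.
  move=> ki kj; rewrite /A /at_coord (negbTE ki) (negbTE kj).
  by rewrite /pushforward preimage_setT probability_setT.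
have ii : (i < j.+1)%N by rewrite ltnS ltnW.
rewrite (ip _ mA) (bigD1 (Ordinal ii))//= (bigD1 ord_max)/=; last first.
  by rewrite -val_eqE/= gtn_eqF.
rewrite big1 ?mule1 => [|k /andP[ki kj]]; last first.
  by rewrite pA.
by rewrite /A /at_coord !eqxx gtn_eqF.
Qed.

Lemma measure_coordE i (B : set X) : measurable B ->
  p (@coord _ X i @^-1` B) = p (@coord _ X 0%N @^-1` B).
Proof.
move=> mB; rewrite -[RHS](hp (finite_perm_swap 0%N i)).
  by rewrite /pushforward preimage_coord_swap.
exact: (measurable_preimage (measurable_coord 0%N)).
Qed.

(** In the induction step, the events that coordinate [n + i] lies in [A n] are pairwise independent
    and equiprobable. They all meet the intersection of [D] with [box n A] in the same probability,
    so that intersection is independent of each of them. *)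
Lemma invariant_set_independent_box D n A : invariant_set p D ->
  (forall i, measurable (A i)) -> p (D `&` box n A) = p D * p (box n A).
Proof.
move=> iD mA; have mD := iD.1.
have mc i B : measurable B -> measurable (@coord _ X i @^-1` B).
  exact: (measurable_preimage (measurable_coord i)).
have finp C : measurable C -> p C = (fine (p C))%:E.
  by move=> mC; rewrite fineK// fin_num_measure.
elim: n => [|n IH]; first by rewrite box0 setIT probability_setT mule1.
have -> : p (box n.+1 A) = p (box n A) * p (@coord _ X n @^-1` A n).
  by rewrite !ip// big_ord_recr.
have mB := measurable_box n mA.
have mE i := mc (n + i)%N _ (mA n).
rewrite muleA -IH boxS setIA [in RHS](finp _ (mc n _ (mA n))).
have mDB := measurableI _ _ mD mB.
(* Swapping [n] and [n + i] leaves the first [n] coordinates, and hence [box n A], unchanged. *)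
have w i : p ((D `&` box n A) `&` @coord _ X (n + i)%N @^-1` A n) =
    (fine (p ((D `&` box n A) `&` @coord _ X n @^-1` A n)))%:E.
  rewrite -finp; last by apply: measurableI => //; exact: mc.
  rewrite -!setIA -[RHS](invariant_set_setI iD _ (finite_perm_swap n (n + i)%N)).
    by rewrite preimage_setI box_swap// ?leq_addr// preimage_coord_swap.
  by apply: measurableI => //; exact: mc.
rewrite -(pairwise_independent_constant_inter mDB mE _ _ w).
- by rewrite -(w 0%N) addn0.
- by move=> i; rewrite measure_coordE// -(measure_coordE n)// -finp//; exact: mc.
- move=> i j ij; rewrite independent_coord2// ?eqn_add2l//.
  by rewrite !(measure_coordE (n + _)%N)// -(measure_coordE n)// EFinM -finp//; exact: mc.
Qed.

(** The restriction of [p] to [D] and the multiple of [p] by [p D] agree on boxes, hence on all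
    measurable sets; at [D] itself this reads [p D = p D * p D]. *)
Lemma independent_ergodic : ergodic p.
Proof.
move=> D iD; have mD : measurable (D : set (seq_space X)) := iD.1.
suff : p D = p D * p D.
  have : p D \is a fin_num by exact: fin_num_measure.
  change (p D \is a fin_num -> p D = p D * p D -> p D = 0 \/ p D = 1).
  case: (p D) => // r _ /eqP.
  rewrite -EFinM eqe -subr_eq0 -[X in (X - _)%R]mulr1 -mulrBr mulf_eq0 subr_eq0.
  by move=> /orP[/eqP->|/eqP<-]; [left|right].
rewrite -{1}(setIid D).
have r0 : (0 <= fine (p D))%R by exact: fine_ge0.
transitivity (mscale (NngNum r0) p D); last first.
  by rewrite /mscale/= fineK// fin_num_measure.
change (mrestr p mD D = mscale (NngNum r0) p D).
apply: box_measure_unique => //.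
  rewrite /= /mrestr (le_lt_trans (probability_le1 _ _)) ?ltry//.
  exact: measurableI.
move=> n A mA; rewrite /= /mrestr /mscale/= setIC.
rewrite invariant_set_independent_box// fineK// fin_num_measure//.
Qed.

End exchangeable_theory.

(** * Ergodic exchangeable measures are infinite powers *)

Section ergodic_product.
Context (R : realType) d (X : measurableType d).
Variable p : probability (seq_space X) R.
Hypothesis hp : exchangeable p.
Hypothesis ep : ergodic p.
Implicit Types (A : nat -> set X) (B C D : set (seq_space X)).

(* The Radon-Nikodym derivative of [nu] with respect to [p] is a.s. invariant,
   hence a.s. constant. *)
Lemma ergodic_extremal (nu : {measure set (seq_space X) -> \bar R}) :
  (forall B, measurable B -> nu B <= p B) ->
  (forall s B, finite_perm s -> measurable B -> nu (permute s @^-1` B) = nu B) ->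
  forall B, measurable B -> nu B = nu setT * p B.
Proof.
move=> nup nus.
have pfin B : measurable B -> p B \is a fin_num.
  by move=> ?; exact: fin_num_measure.
have nufin : fin_num_fun nu.
  move=> B mB; rewrite ge0_fin_numE//; apply: le_lt_trans (nup B mB) _.
  by rewrite -ge0_fin_numE//; exact: pfin.
have nuoo : nu setT < +oo by rewrite -ge0_fin_numE//; exact: nufin.
have nup0 : mfrestr measurableT nuoo `<< p.
  apply/null_content_dominatesP => B mB pB0; rewrite /= /mfrestr /mrestr setIT.
  by apply/eqP; rewrite eq_le measure_ge0 andbT -pB0; exact: nup.
have [h [h0 hint hE']] := radon_nikodym_finite nup0.
have hE B : measurable B -> nu B = \int[p]_(x in B) h x.
  by move=> mB; rewrite -hE'//= /mfrestr /mrestr setIT.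
have mh : measurable_fun setT h by exact: measurable_int hint.
have mperm s := @measurable_permute _ X s.
have hs s : finite_perm s -> ae_eq p setT h (h \o permute s).
  move=> fs; have [[t st ts] _] := fs.
  apply: integral_ae_eq => //; first exact: measurableT_comp.
  move=> E _ mE; rewrite -hE//.
  have mtE : measurable (permute t @^-1` E) by exact: measurable_preimage.
  (* Written as a preimage under [permute s], the set [E] allows a change of variables in the
     integral of [h \o permute s]. *)
  have Es : E = permute s @^-1` (permute t @^-1` E).
    apply/seteqP; split=> x /=; congr (E _);
    by apply/funext => i; rewrite /permute /coord ts.
  rewrite [in RHS]Es -(ge0_integral_pushforward (mperm s))//; last first.
    exact: measurable_funTS.
  rewrite (@eq_measure_integral _ _ _ _ p)//; last by move=> ? ? _; exact: hp.
  by rewrite -hE// {1}Es; exact: nus.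
(* The mean of [h] is [c]; the invariant set where [h] exceeds its mean is null or of full
   measure. *)
pose c := nu setT.
pose D := [set x | c < h x].
have cfin : c \is a fin_num by exact: nufin.
have mD : measurable D.
  by rewrite -[D]setTI; exact: emeasurable_fun_o_infty.
have iD : invariant_set p D.
  split=> // s fs; move: (hs s fs); apply: filterS => x /= /(_ Logic.I) hx _.
  rewrite !indicE; congr ((nat_of_bool _)%:R).
  by apply/idP/idP; rewrite !inE /D /= -hx.
(* As [nu] and [c * p] have the same total mass, an inequality between them on both [B] and its
   complement is an equality. *)
have nuE B : measurable B ->
    (nu B <= c * p B /\ nu (~` B) <= c * p (~` B)) \/
    (c * p B <= nu B /\ c * p (~` B) <= nu (~` B)) -> nu B = c * p B.
  move=> mB; have mBC := measurableC mB.
  have : p B + p (~` B) = p setT by rewrite -measureU// ?setUCr ?setICr.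
  rewrite probability_setT.
  have : nu B + nu (~` B) = c by rewrite -measureU// ?setUCr ?setICr.
  rewrite -(fineK (pfin _ mB)) -(fineK (pfin _ mBC)).
  rewrite -(fineK (nufin _ mB)) -(fineK (nufin _ mBC)) -(fineK cfin).
  rewrite -!EFinM -!EFinD !lee_fin => -[nuc] [pc] cmp; congr EFin.
  by case: cmp => -[]; nra.
have intc B : measurable B -> c * p B = \int[p]_(x in B) cst c x.
  by move=> mB; rewrite -(fineK cfin) integral_cst.
have mhB B : measurable_fun B h by exact: measurable_funTS.
have [D0|D1] := ep iD.
  have le B : measurable B -> nu B <= c * p B.
    move=> mB; rewrite (hE B mB) intc//.
    apply: ae_ge0_le_integral => //.
    exists D; split=> // x /=; apply: contra_notP.
    by move=> /negP; rewrite -leNgt => ? _.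
  by move=> B mB; apply: nuE => //; left; split; apply: le => //;
     exact: measurableC.
have le B : measurable B -> c * p B <= nu B.
  move=> mB; rewrite (hE B mB) intc//.
  apply: ae_ge0_le_integral => //.
  exists (~` D); split=> //; first exact: measurableC.
    have := probability_setC p mD; rewrite [p D]D1 subee//.
  by move=> x /=; apply: contra_not => /ltW.
by move=> B mB; apply: nuE => //; right; split; apply: le => //;
   exact: measurableC.
Qed.

(** As a function of [C], the left side is a measure dominated by [p] and invariant under finite
    permutations, so [ergodic_extremal] makes it a multiple of [p]. *)
Lemma ergodic_coord0_shift (B : set X) C : measurable B -> measurable C ->
  p (@coord _ X 0%N @^-1` B `&` @shift _ X @^-1` C) =
  p (@coord _ X 0%N @^-1` B) * p C.
Proof.
move=> mB mC; set E := _ @^-1` B.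
have mE : measurable E by exact: (measurable_preimage (measurable_coord 0%N)).
have mS := @measurable_shift _ X.
(* The witness is the restriction of [p] to [E], pushed forward along the shift. *)
have [nu nuE] : exists nu : {measure set (seq_space X) -> \bar R},
    forall C, nu C = p (E `&` @shift _ X @^-1` C).
  unshelve refine (ex_intro _ (pushforward (mrestr p mE) (@shift _ X) :
    {measure set (seq_space X) -> \bar R}) _) => //.
  by move=> C'; rewrite /pushforward/= /mrestr setIC.
have mpS C' : measurable C' -> measurable (@shift _ X @^-1` C').
  exact: measurable_preimage.
have -> : p E = nu setT by rewrite nuE preimage_setT setIT.
rewrite -nuE; apply: ergodic_extremal => // {mC C}[C mC|s C fs mC]; rewrite !nuE.
  rewrite -(exchangeable_shift hp mC).
  by apply: le_measure; rewrite ?inE//; [apply: measurableI => //; exact: mpS|exact: mpS].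
(* The lifted permutation fixes coordinate 0 and so preserves [E]. *)
rewrite -[RHS](hp (finite_perm_lift fs)); last first.
  by apply: measurableI => //; exact: mpS.
by [].
Qed.

Lemma ergodic_box n A : (forall i, measurable (A i)) ->
  p (box n A) = \prod_(i < n) p (@coord _ X 0%N @^-1` A i).
Proof.
elim: n A => [|n IH] A mA; first by rewrite box0 big_ord0 probability_setT.
rewrite boxSl ergodic_coord0_shift//; last first.
  by apply: measurable_box => i; exact: mA.
by rewrite IH => [|i]; [rewrite big_ord_recl|exact: mA].
Qed.

End ergodic_product.

(** * Mixing measures of an infinite power *)

Section de_finetti_dirac.
Context (R : realType) d (X : measurableType d).
Local Notation PX := (pprobability X R).
Implicit Types (A : nat -> set X) (B : set X) (q : probability X R).

Lemma measurable_eval B : measurable B ->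
  measurable_fun [set: PX] (fun q : PX => (q : probability X R) B).
Proof. exact: (measurable_kernel (kprobability (@measurable_id _ PX setT))). Qed.

Lemma measurable_prod_eval n A : (forall i, measurable (A i)) ->
  measurable_fun [set: PX]
    (fun q : PX => \prod_(i < n) (q : probability X R) (A i)).
Proof.
move=> mA; elim: n => [|n IH].
  by under eq_fun do rewrite big_ord0; exact: measurable_cst.
under eq_fun do rewrite big_ord_recr/=.
by apply: emeasurable_funM => //; exact: measurable_eval.
Qed.

Lemma integral_prod_eval_dirac (mu : probability PX R) q n A :
  (forall i, measurable (A i)) ->
  (forall C, measurable C -> mu C = \d_(q : PX) C) ->
  \int[mu]_r \prod_(i < n) (r : probability X R) (A i) =
  \prod_(i < n) q (A i).
Proof.
move=> mA muq; rewrite (@eq_measure_integral _ _ _ _ \d_(q : PX)); last first.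
  by move=> C mC _; exact: muq.
by rewrite integral_dirac//; [rewrite diracT mul1e|exact: measurable_prod_eval].
Qed.

Variable p : probability (seq_space X) R.
Variable q : probability X R.
Hypothesis pq : is_product_of p (fun=> q).

(** Under [nu] the variable [r B] has mean [q B] and variance zero. *)
Lemma mixing_ae_eval (nu : probability PX R) B : mixing_measure p nu ->
  measurable B ->
  \forall r \ae nu, (r : probability X R) B = q B.
Proof.
move=> mix mB.
pose f (r : PX) : R := fine ((r : probability X R) B).
have fin (r : probability X R) : r B = (fine (r B))%:E.
  by rewrite fineK// fin_num_measure.
have bf : bounded_measurable f.
  split.
    by apply: (measurableT_comp (fine_measurable measurableT));
       exact: measurable_eval.
  exists 1%R => r; rewrite ger0_norm ?fine_ge0// -lee_fin -[leLHS]fin.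
  exact: probability_le1.
have prodE (r : probability X R) n :
    \prod_(i < n) r B = (fine (r B) ^+ n)%:E.
  by rewrite (eq_bigr (fun=> (fine (r B))%:E))// prodEFin prodr_const card_ord.
(* The box with [n] sides equal to [B] computes the moment of order [n]. *)
have moment n : (\int[nu]_r (f r ^+ n) = fine (q B) ^+ n)%R.
  transitivity (fine (\int[nu]_r \prod_(i < n) (r : probability X R) B)).
    by congr fine; apply: eq_integral => r _; rewrite prodE.
  by rewrite -(mix n (fun=> B))// pq// prodE.
pose g r := (f r + - fine (q B))%R.
have bg : bounded_measurable g.
  by apply: bounded_measurableD => //; exact: bounded_measurable_cst.
have bgg := bounded_measurableM bg bg.
have Ig : (\int[nu]_r (g r * g r) = 0)%R.
  have -> : (fun r => g r * g r)%R =
     (fun r => f r ^+ 2 + (- (2 * fine (q B)) * f r ^+ 1 + fine (q B) ^+ 2))%R.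
    by apply/funext => r; rewrite /g; ring.
  have bff := bounded_measurableM bf bf.
  have bcf := bounded_measurableM
    (@bounded_measurable_cst _ PX R (- (2 * fine (q B)))%R) bf.
  have bc := @bounded_measurable_cst _ PX R (fine (q B) ^+ 2)%R.
  rewrite RintegralTD//; last exact: bounded_measurableD.
  by rewrite RintegralTD// RintegralTZl// RintegralT_cst !moment; ring.
have : ae_eq nu setT (fun r => (g r * g r)%:E) (cst 0).
  apply/ae_eq_integral_abs => //; first by apply/measurable_EFinP; case: bgg.
  under eq_integral do rewrite gee0_abs ?lee_fin -?expr2 ?sqr_ge0//.
  have := bounded_measurable_integrable nu bgg.
  by move=> /(integrable_fin_num measurableT) /fineK <-; congr EFin.
apply: filterS => r /(_ Logic.I) [] /eqP; rewrite mulf_eq0 orbb subr_eq0 => /eqP e.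
by rewrite [LHS]fin [RHS]fin; congr EFin.
Qed.

(** The sets [C] with this property form a sigma-algebra; membership in a generator depends on [r]
    only through some [r B], which is a.s. [q B]. *)
Lemma mixing_ae_mem (nu : probability PX R) (C : set PX) : mixing_measure p nu ->
  measurable C -> \forall r \ae nu, C r <-> C q.
Proof.
move=> mix mC; have ae := @filterS _ _ (ae_filter_ringOfSetsType nu).
suff: [set C : set PX | \forall r \ae nu, C r <-> C q] C by [].
move: C mC; apply: smallest_sub; first split=> [|D /= hD|F hF] /=.
- exact: aeW.
- by apply: filterS hD => r /= hr; rewrite /setD /=; split=> -[_ h]; split=> // /hr.
- have hFi : \forall r \ae nu, forall i, F i r <-> F i q by exact: ae_foralln.
  apply: ae hFi => r hr; split=> -[i _ Fi]; exists i => //; exact/hr.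
move=> _ [x _ [B mB <-]] /=.
by apply: ae (mixing_ae_eval mix mB) => r; rewrite /mset/= => ->.
Qed.

Lemma mixing_dirac (nu : probability PX R) (C : set PX) : mixing_measure p nu ->
  measurable C -> nu C = \d_(q : PX) C.
Proof.
move=> mix mC; have mCC := measurableC mC; have := mixing_ae_mem mix mC.
rewrite diracE; case: (pselect (C q)) => Cq hC.
  have nC : nu (~` C) = 0.
    apply: measure_negligible => //; apply: negligibleS hC => r /= nCr h.
    by apply: nCr; apply/h.
  by rewrite mem_set//= -[C]setCK probability_setC// nC sube0.
rewrite memNset//=; apply: measure_negligible => //.
by apply: negligibleS hC => r /= Cr h; apply: Cq; apply/h.
Qed.

Lemma product_de_finetti_dirac :
  is_de_finetti_measure p (\d_(q : PX) : probability PX R).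
Proof.
have mix : mixing_measure p (\d_(q : PX) : probability PX R).
  by move=> n A mA; rewrite (integral_prod_eval_dirac (q := q))// pq.
split=> // nu mixnu C mC; rewrite [LHS](mixing_dirac mixnu mC).
by [].
Qed.

End de_finetti_dirac.

Lemma de_finetti_dirac_independent (R : realType) d (X : measurableType d)
    (p : probability (seq_space X) R)
    (mu : probability (pprobability X R) R) :
  mixing_measure p mu -> is_dirac mu -> independent_components p.
Proof.
move=> mix [q muq]; apply/independent_componentsP.
exists (fun=> q : probability X R) => n A mA.
by rewrite mix// (integral_prod_eval_dirac n mA muq).
Qed.

(** * Deterministic invariant kernels and ergodicity *)

Lemma standard_borel_open_real (R : realType) :
  standard_borel R (g_sigma_algebraType [set U : set R | open U]).
Proof.
exists (R^o : metricType R), id; split.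
- move=> F FF cF; exists (lim (F : set_system R)); exact: (@cauchy_cvg R F FF cF).
- exists (range (ratr : rat -> R)); last exact: dense_rat.
  apply: card_le_trans (card_image_le _ _) _; exact: countableP.
- by exists id.
by apply/seteqP; split=> [B mB|_ [B mB <-]] //; exists B.
Qed.

Section invariant_kernels.
Context (R : realType) d (X : measurableType d).
Variable p : probability (seq_space X) R.
Implicit Types D : set (seq_space X).

(** The Borel sigma-algebra of the line in the form used by [standard_borel]; this is the target of
    the test kernels below. *)
Local Notation RB := (g_sigma_algebraType [set U : set R | open U]).

Lemma measurable_indic_open D : measurable D ->
  measurable_fun [set: seq_space X] (\1_D : seq_space X -> RB).
Proof.
move=> mD; apply: (@measurability _ _ _ RB _ _ [set U : set R | open U]) => //.
move=> _ [U oU <-].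
exact: (measurable_indic mD measurableT (open_measurable oU)).
Qed.

(** The test kernel is the Dirac kernel of the indicator of [D]: it is deterministic, and a.s.
    invariant because [D] is. *)
Lemma kernel_condition_ergodic :
  (forall (d' : measure_display) (Y : measurableType d')
     (s : R.-pker (seq_space X) ~> Y),
     standard_borel R Y -> ae_deterministic p s ->
     ae_permutation_invariant p s -> deterministic (kernel_image p s)) ->
  ergodic p.
Proof.
move=> H D [mD iD].
have mf := measurable_indic_open mD.
pose s : R.-pker (seq_space X) ~> RB := kdirac mf.
have ds : ae_deterministic p s.
  move=> A B B' mA mB mB'; apply: eq_integral => x _.
  rewrite /s /kdirac /= !diracE in_setI.
  by case: (_ \in B); case: (_ \in B'); rewrite /= ?mule1 ?mule0.
have ips : ae_permutation_invariant p s.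
  move=> t ft A B mA mB; apply: ae_eq_integral => //.
  - apply: measurable_funTS; apply: (measurableT_comp (measurable_kernel s B mB)).
    exact: measurable_permute.
  - by apply: measurable_funTS; exact: (measurable_kernel s B mB).
  move: (iD t ft); apply: filterS => x /(_ Logic.I) h _.
  by rewrite /s /kdirac/= !diracE; congr (((_ \in B) : nat)%:R%:E).
(* This open set contains 1 but not 0, so it recovers [D] from its indicator. *)
pose B : set RB := [set y : R | (0 < y)%R].
have mB : measurable B by apply: sub_sigma_algebra; exact: open_gt.
have kD : kernel_image p s B = p D.
  transitivity (\int[p]_x (\1_D x)%:E); last by rewrite integral_indic// setIT.
  apply: eq_integral => x _; rewrite /s /kdirac/= diracE indicE.
  congr ((_ : bool)%:R%:E).
  by case: (x \in D); [rewrite mem_set//=; exact: ltr01|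
    rewrite memNset// /B/= ltxx].
have := H _ RB s (standard_borel_open_real R) ds ips B mB.
change (kernel_image p s B = 0 \/ kernel_image p s B = 1 ->
  p D = 0 \/ p D = 1).
by rewrite kD.
Qed.

(** Determinism makes [s x B] a.s. idempotent, hence a.s. the indicator of the set where it is
    positive. That set is invariant, so ergodicity gives it measure 0 or 1. *)
Lemma ergodic_kernel_image d' (Y : measurableType d')
    (s : R.-pker (seq_space X) ~> Y) :
  ergodic p -> ae_deterministic p s -> ae_permutation_invariant p s ->
  deterministic (kernel_image p s).
Proof.
move=> ep ds ips B mB.
pose f x := s x B.
have mf : measurable_fun setT f := measurable_kernel s B mB.
have f0 x : 0 <= f x by exact: measure_ge0.
have f1 x : f x <= 1.
  by rewrite -(prob_kernel (s := s) x); apply: le_measure; rewrite ?inE.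
have fint : p.-integrable setT f.
  apply: (le_integrable _ mf (g := EFin \o cst 1%R)) => //.
    by move=> x _; rewrite /= gee0_abs// normr1; exact: f1.
  exact: finite_measure_integrable_cst.
(* This is determinism with both target sets equal to [B]. *)
have ff : ae_eq p setT f (f \* f).
  apply: integral_ae_eq => //; first exact: emeasurable_funM.
  by move=> E _ mE; rewrite -[RHS]ds// setIid.
have fs t : finite_perm t -> ae_eq p setT f (f \o permute t).
  move=> ft; apply: integral_ae_eq => //.
    exact: (measurableT_comp mf (@measurable_permute _ X t)).
  by move=> E _ mE; rewrite -(ips t ft E B).
pose D := [set x | 0 < f x].
have mD : measurable D by rewrite -[D]setTI; exact: emeasurable_fun_o_infty.
have iD : invariant_set p D.
  split=> // t /fs; apply: filterS => x /= /(_ Logic.I) hx _.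
  rewrite !indicE; congr ((nat_of_bool _)%:R).
  by apply/idP/idP; rewrite !inE /D /= -hx.
suff kD : kernel_image p s B = p D.
  change (kernel_image p s B = 0 \/ kernel_image p s B = 1).
  by rewrite kD; exact: ep iD.
transitivity (\int[p]_x (\1_D x)%:E); last by rewrite integral_indic// setIT.
apply: ae_eq_integral => //; first by apply/measurable_EFinP; exact: measurable_indic.
apply: filterS ff => x /(_ Logic.I)/= + _; rewrite indicE -/(f x).
have fin : f x \is a fin_num.
  by rewrite ge0_fin_numE// (le_lt_trans (f1 x)) ?ltry.
have -> : (x \in D) = (0 < f x) by apply/idP/idP; rewrite inE.
move: fin (f0 x); case: (f x) => // r _; rewrite lee_fin => r0.
move=> [] /eqP; rewrite -subr_eq0 -[X in (X - _ == _)%R]mulr1 -mulrBr mulf_eq0 subr_eq0.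
by rewrite lte_fin => /orP[/eqP->|/eqP<-]; rewrite ?ltxx ?ltr01.
Qed.

End invariant_kernels.

(** * The five conditions in a cycle of implications *)

Theorem theorem4p4 (R : realType) (d : measure_display) (X : measurableType d)
    (hX : standard_borel R X)
    (p : probability (seq_space X) R) (hp : exchangeable p) :
  [<-> ergodic p;
       deterministic (p_inv p);
       forall (d' : measure_display) (Y : measurableType d')
         (s : R.-pker (seq_space X) ~> Y),
         standard_borel R Y ->
         ae_deterministic p s -> ae_permutation_invariant p s ->
         deterministic (kernel_image p s);
       exists2 mu : probability (pprobability X R) R,
         is_de_finetti_measure p mu & is_dirac mu;
       independent_components p].
Proof.
do !split.
- by [].
- by move=> ep d' Y s _; exact: ergodic_kernel_image.
(* The kernel condition is first turned into ergodicity, which makes [p] the infinite power of the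
   law [q] of coordinate 0. *)
- move=> /kernel_condition_ergodic ep.
  pose q : probability X R := distribution p (@coord _ X 0%N).
  have pq : is_product_of p (fun=> q) by move=> n A; exact: ergodic_box.
  exists \d_(q : pprobability X R); first exact: product_de_finetti_dirac.
  by exists q.
- by move=> [mu [mix _]]; exact: de_finetti_dirac_independent.
- exact: independent_ergodic.
Qed.
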